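(* Let $n$ be a positive integer and $q = 2^n$. Let $L_{A_n}$ be the set of leaves of $G_q$ contained in $A_n$, and let $$S_{q+1} := \{\alpha \in \mathbb{F}_q^* : D_{q+1}(\alpha) = D_{q+1}(\alpha^{-1}) = 0\}.$$ Then $L_{A_n}$ is not empty and $S_{q+1} = L_{A_n}$.
   Context: $D_m(x) = \sum_{i=0}^{\lfloor m/2 \rfloor} \frac{m}{m-i}\binom{m-i}{i}(-1)^i x^{m-2i} \in \mathbb{F}_q[x]$ is the Dickson polynomial of the first kind of degree $m>0$ with parameter $1$ (the integer coefficients being reduced mod $2$); it satisfies $D_m(x+x^{-1}) = x^m + x^{-m}$. The map $\theta$ on $\mathbf{P}^1(\mathbb{F}_q) = \mathbb{F}_q \cup \{\infty\}$ is defined by $\theta(0) = \theta(\infty) = \infty$ and $\theta(x) = x + x^{-1}$ otherwise. $G_q$ is the directed graph with vertex set $\mathbf{P}^1(\mathbb{F}_q)$ and an arrow from $\alpha$ to $\theta(\alpha)$ for each vertex $\alpha$. A leaf of $G_q$ is a vertex with no incoming arrow, i.e. not of the form $\theta(x)$ with $x \in \mathbf{P}^1(\mathbb{F}_q)$. $\mathrm{Tr}_n(x) = \sum_{j=0}^{n-1} x^{2^j}$ is the absolute trace on $\mathbb{F}_{2^n}$, and $A_n := \{\alpha \in \mathbb{F}_q^* : \mathrm{Tr}_n(\alpha) = \mathrm{Tr}_n(\alpha^{-1})\} \cup \{0, \infty\}$. *)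

(* Defs.v *)
From HB Require Import structures.
From mathcomp Require Import all_boot all_order all_algebra.
Set Implicit Arguments.
Unset Strict Implicit.
Unset Printing Implicit Defensive.
Import GRing.Theory.
Local Open Scope ring_scope.

(* The integer m/(m-i) * binom(m-i, i); the division is exact for
   0 < m and i <= m/2, see dickson_coef_exact. *)
Definition dickson_coef (m i : nat) : nat := (m * 'C(m - i, i) %/ (m - i))%N.

Lemma dickson_coef_exact (m i : nat) :
  (0 < m)%N -> (i <= m./2)%N ->
  (dickson_coef m i * (m - i) = m * 'C(m - i, i))%N.
Proof.
rewrite geq_half_double -addnn => m0 im.
have im2 : (i <= m)%N := leq_trans (leq_addr i i) im.
rewrite /dickson_coef divnK //.
rewrite -[X in (X * _)%N](subnK im2) mulnDl dvdn_addr;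
  last exact: dvdn_mulr.
case: i im im2 => [|i] im im2; first by rewrite mul0n dvdn0.
have : (0 < m - i.+1)%N by rewrite subn_gt0 (leq_trans _ im) // addSn ltnS leq_addl.
by case: (m - i.+1)%N => // k _; rewrite -mul_bin_diag dvdn_mulr.
Qed.

Definition dickson (R : comNzRingType) (m : nat) : {poly R} :=
  \sum_(i < m./2.+1) ((-1) ^+ i * (dickson_coef m i)%:R) *: 'X^(m - 2 * i).

(* The projective line P^1(F) is option F, with None the point at infinity. *)
Definition theta (F : finFieldType) (x : option F) : option F :=
  match x with
  | Some a => if a == 0 then None else Some (a + a^-1)
  | None => None
  end.

Definition Gq (F : finFieldType) : rel (option F) :=
  [rel x y | theta x == y].

Definition leaves (T : finType) (e : rel T) : {set T} :=
  [set y | [forall x, ~~ e x y]].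

(* The absolute trace of a field of order 2 ^ n, viewed in the field itself. *)
Definition Tr (F : finFieldType) (n : nat) (x : F) : F :=
  \sum_(j < n) x ^+ (2 ^ j).

Definition A_set (F : finFieldType) (n : nat) : {set option F} :=
  [set Some a | a in [set a : F | (a != 0) && (Tr n a == Tr n a^-1)]]
    :|: [set Some 0; None].

Definition L_A (F : finFieldType) (n : nat) : {set option F} :=
  leaves (@Gq F) :&: A_set F n.

Definition S_set (F : finFieldType) (m : nat) : {set F} :=
  [set a : F | [&& a != 0, (dickson F m).[a] == 0
                         & (dickson F m).[a^-1] == 0]].

(* Main.v *)
Require Import Defs.
From mathcomp Require Import all_boot all_order all_algebra.
From mathcomp Require Import finfield ring zify.

Set Implicit Arguments.
Unset Strict Implicit.
Unset Printing Implicit Defensive.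
Import GRing.Theory.
Local Open Scope ring_scope.

(** In characteristic 2 the Dickson recurrence gives
    [D_(2m+1) = D_m D_(m+1) + D_1], hence
    [D_(q+1)(a) = a^(q+1) (1 + Tr (a^-2))] for [a != 0].  Substituting
    [x = a y] turns [x + x^-1 = a] into [y^2 + y = a^-2], which by the additive
    form of Hilbert 90 is solvable iff [Tr (a^-2) = 0].  So for [a != 0] being a
    leaf, [D_(q+1)(a) = 0] and [Tr (a^-1) = 1] are equivalent, and the two sets
    of the theorem both equal [{a | Tr a = Tr a^-1 = 1}].  This set is nonempty
    because [Tr a = 1] and [Tr a^-1 = 1] each cut out at least [q / 2] elements
    among the [q - 1] nonzero ones. *)

(** * Dickson polynomials *)

Lemma dickson_coef0 m : (0 < m)%N -> dickson_coef m 0 = 1%N.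
Proof. by move=> m0; rewrite /dickson_coef subn0 bin0 muln1 divnn m0. Qed.

Lemma dickson_coef_small m i : (m < i.*2)%N -> dickson_coef m i = 0%N.
Proof.
by move=> h; rewrite /dickson_coef bin_small ?muln0 ?div0n //; lia.
Qed.

(** Division-free form: since [(i.+1) * 'C(k.+1, i.+1) = k.+1 * 'C(k, i)], the factor [k.+1] splits
    off the numerator. Pascal's rule can then be applied to each binomial. *)
Lemma dickson_coefS k i :
  dickson_coef (k + i.+2) i.+1 = ('C(k.+1, i.+1) + 'C(k, i))%N.
Proof.
rewrite /dickson_coef.
have -> : (k + i.+2 - i.+1 = k.+1)%N by lia.
have -> : (k + i.+2 = k.+1 + i.+1)%N by lia.
by rewrite mulnDl -mul_bin_diag -mulnDr mulKn.
Qed.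

Lemma dickson_coef_rec m i : (0 < m)%N ->
  dickson_coef m.+2 i.+1 = (dickson_coef m.+1 i.+1 + dickson_coef m i)%N.
Proof.
case: m => // m _; case: i => [|i].
  rewrite dickson_coef0 //.
  have -> : m.+3 = (m.+1 + 2)%N by lia.
  have -> : m.+2 = (m + 2)%N by lia.
  by rewrite !dickson_coefS !bin0 !bin1; lia.
case: (leqP m i) => him; first by rewrite !dickson_coef_small //; lia.
have -> : m = ((m - i.+1) + i.+1)%N by lia.
move: (m - i.+1)%N => k.
have -> : (k + i.+1).+3 = (k.+1 + i.+3)%N by lia.
have -> : (k + i.+1).+2 = (k + i.+3)%N by lia.
have -> : (k + i.+1).+1 = (k + i.+2)%N by lia.
by rewrite !dickson_coefS !(binS k.+1) !(binS k); lia.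
Qed.

(** The added coefficients vanish. A free choice of [N] lets the three sums of the recurrence be
    matched term by term. *)
Lemma dickson_widen (R : comNzRingType) m N : (m./2 < N)%N ->
  dickson R m =
  \sum_(i < N) ((-1) ^+ i * (dickson_coef m i)%:R) *: 'X^(m - 2 * i).
Proof.
move=> hN; rewrite /dickson.
pose G i : {poly R} := ((-1) ^+ i * (dickson_coef m i)%:R) *: 'X^(m - 2 * i).
rewrite (big_ord_widen N G hN) big_mkcond; apply: eq_bigr => i _.
case: ifPn => // hi.
by rewrite dickson_coef_small ?mulr0 ?scale0r //; lia.
Qed.

Lemma dickson_rec (R : comNzRingType) m : (0 < m)%N ->
  dickson R m.+2 = 'X * dickson R m.+1 - dickson R m.
Proof.
move=> m0; rewrite (@dickson_widen _ m.+2 m.+2) ?(@dickson_widen _ m.+1 m.+2)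
  ?(@dickson_widen _ m m.+1); try lia.
rewrite !(big_ord_recl m.+1) !dickson_coef0 // mulrDr -addrA; congr (_ + _).
  by rewrite muln0 !subn0 expr0 mul1r !scale1r -exprS.
rewrite mulr_sumr -sumrB; apply: eq_bigr => i _ /=.
rewrite /bump /= add1n dickson_coef_rec // natrD mulrDr scalerDl; congr (_ + _).
  case: (leqP (2 * i.+1) m.+1) => hi.
    rewrite -scalerAr -exprS; congr (_ *: 'X^_); lia.
  by rewrite dickson_coef_small ?mulr0 ?scale0r ?mulr0 //; lia.
rewrite exprS mulN1r mulNr scaleNr; congr (- (_ *: 'X^_)); lia.
Qed.

(** The coefficient is a division by zero, with value 0. The usual convention [D_0 = 2] agrees with
    this only modulo 2, so the recurrence extends to [m = 0] in characteristic 2. *)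
Lemma dickson0 (R : comNzRingType) : dickson R 0 = 0.
Proof.
by rewrite /dickson big_ord1 (_ : dickson_coef 0 _ = 0%N) // mulr0 scale0r.
Qed.

Lemma dickson1 (R : comNzRingType) : dickson R 1 = 'X.
Proof.
by rewrite /dickson big_ord1 dickson_coef0 // mulr1 scale1r muln0 subn0.
Qed.

Lemma dickson2 (R : comNzRingType) : dickson R 2 = 'X^2 - (2%:R)%:P.
Proof.
rewrite /dickson big_ord_recl big_ord1 dickson_coef0 // muln0 subn0.
rewrite expr0 mul1r scale1r; congr (_ + _).
by rewrite /= expr1 mulN1r scaleNr expr0 alg_polyC.
Qed.

(** * Values of Dickson polynomials in characteristic 2 *)

Section Char2.

Variables (R : comNzRingType) (R2 : 2%N \in [pchar R]) (a : R).

Let d m := (dickson R m).[a].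

Lemma dickson_rec_pchar2 m : d m.+2 = a * d m.+1 + d m.
Proof.
rewrite /d; case: m => [|m].
  by rewrite dickson2 dickson1 dickson0 (pcharf0 R2) !hornerE subr0 expr2.
by rewrite dickson_rec // !hornerE oppr_pchar2.
Qed.

(** The quadratic form [u^2 + a u v + v^2] is invariant under the recurrence step; at
    [(d 0, d 1) = (0, a)] it equals [a^2]. *)
Lemma dickson_quadratic m : d m.+1 ^+ 2 = a ^+ 2 + d m ^+ 2 + a * d m * d m.+1.
Proof.
elim: m => [|m IH]; first by rewrite /d dickson0 dickson1 !hornerE; ring.
rewrite dickson_rec_pchar2.
have -> : (a * d m.+1 + d m) ^+ 2 =
  a ^+ 2 * d m.+1 ^+ 2 + d m ^+ 2 + a * d m * d m.+1 + a * d m * d m.+1 by ring.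
rewrite addrK_pchar2 // {2}IH.
have -> : a ^+ 2 + (a ^+ 2 + d m ^+ 2 + a * d m * d m.+1) +
    a * d m.+1 * (a * d m.+1 + d m) =
  (a ^+ 2 + a ^+ 2) + (a * d m * d m.+1 + a * d m * d m.+1) + d m ^+ 2 +
    a ^+ 2 * d m.+1 ^+ 2 by ring.
by rewrite !addrr_pchar2 // !add0r addrC.
Qed.

Lemma dickson_double_pchar2 m :
  d m.*2 = d m ^+ 2 /\ d m.*2.+1 = d m * d m.+1 + a.
Proof.
elim: m => [|m [IH0 IH1]].
  by rewrite /d double0 dickson0 dickson1 !hornerE expr0n.
(* The recurrence gives [a * (d m * d m.+1 + a) + d m ^+ 2], which the invariant form collapses to a
   square. *)
have E : d m.+1.*2 = d m.+1 ^+ 2.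
  by rewrite doubleS dickson_rec_pchar2 IH0 IH1 dickson_quadratic; ring.
split=> //; rewrite doubleS dickson_rec_pchar2 -doubleS E IH1.
by rewrite (dickson_rec_pchar2 m); ring.
Qed.

Lemma dickson_exp2 k : d (2 ^ k) = a ^+ (2 ^ k).
Proof.
elim: k => [|k IH]; first by rewrite /d dickson1 hornerX.
by rewrite expnS mul2n (dickson_double_pchar2 _).1 IH -exprM mulnC -mul2n mulnC.
Qed.

End Char2.

(** Doubling gives [D_(2^(k+1)+1) = a^(2^k) D_(2^k+1) + a]; factoring out the power of [a] turns the
    last summand into the next term of the sum, which is a trace at [k = n]. *)
Lemma dickson_exp2S (F : fieldType) (F2 : 2%N \in [pchar F]) (a : F) k :
  a != 0 ->
  (dickson F (2 ^ k).+1).[a] =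
  a ^+ (2 ^ k).+1 * (1 + \sum_(j < k) (a^-1 ^+ 2) ^+ (2 ^ j)).
Proof.
move=> a0; elim: k => [|k IH].
  by rewrite big_ord0 dickson_rec_pchar2 // dickson1 dickson0 !hornerE expr2.
rewrite {1}expnS mul2n (dickson_double_pchar2 F2 a _).2 dickson_exp2 // IH.
rewrite big_ord_recr /= addrA [RHS]mulrDr mulrA; congr (_ * _ + _).
  by rewrite -exprD; congr (_ ^+ _); rewrite expnS; lia.
by rewrite -exprM -expnS exprS -mulrA -exprMn mulfV // expr1n mulr1.
Qed.

(** * The absolute trace *)

Section Trace.

Variables (n : nat) (F : finFieldType).
Hypotheses (hn : (0 < n)%N) (hF : #|F| = (2 ^ n)%N).

Lemma pchar2_card_exp2 : 2%N \in [pchar F].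
Proof. exact: card_finPcharP hF _. Qed.

Let F2 := pchar2_card_exp2.

Lemma TrD (x y : F) : Tr n (x + y) = Tr n x + Tr n y.
Proof.
rewrite /Tr -big_split; apply: eq_bigr => j _ /=.
by rewrite exprDn_pchar // pnatX pnatE ?F2.
Qed.

(** Squaring permutes the summands cyclically, because [x ^+ (2 ^ n) = x]. *)
Lemma Tr_sqr (x : F) : Tr n (x ^+ 2) = Tr n x.
Proof.
rewrite /Tr; case: n hn hF => // m _ hm.
rewrite big_ord_recr big_ord_recl /= addrC; congr (_ + _).
  by rewrite -exprM -expnS -hm expf_card.
by apply: eq_bigr => j _; rewrite -exprM -expnS.
Qed.

(** Being fixed by Frobenius, a trace can only be 0 or 1. *)
Lemma Tr_sqrE (x : F) : Tr n x ^+ 2 = Tr n x.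
Proof.
rewrite -[RHS]Tr_sqr /Tr -(pFrobenius_autE F2) rmorph_sum; apply: eq_bigr => j _ /=.
by rewrite pFrobenius_autE -!exprM mulnC.
Qed.

Lemma Tr_eq1 (x : F) : (Tr n x == 1) = (Tr n x != 0).
Proof.
have [->|T0] := eqVneq (Tr n x) 0; first by rewrite eq_sym oner_eq0.
by apply/eqP/(mulfI T0); rewrite mulr1 -expr2 Tr_sqrE.
Qed.

Lemma Tr0 : Tr n (0 : F) = 0.
Proof. by rewrite /Tr big1 // => j _; rewrite expr0n expn_eq0. Qed.

(** These are roots of a nonzero polynomial of degree [2 ^ n.-1]. *)
Lemma card_Tr0 : (#|[set c : F | Tr n c == 0%R]| <= 2 ^ n.-1)%N.
Proof.
pose p : {poly F} := \sum_(j < n) 'X^(2 ^ j).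
have sp : size p = (2 ^ n.-1).+1.
  rewrite /p; case: n hn => // m _; rewrite big_ord_recr /= addrC size_polyDl.
    by rewrite size_polyXn.
  rewrite size_polyXn ltnS (leq_trans (size_sum _ _ _)) //.
  by apply/bigmax_leqP => j _; rewrite size_polyXn ltn_exp2l.
have p0 : p != 0 by rewrite -size_poly_eq0 sp.
rewrite cardE -ltnS -sp; apply: max_poly_roots => //; last exact: enum_uniq.
apply/allP => c; rewrite mem_enum inE /root => /eqP Tc.
rewrite -[X in _ == X]Tc horner_sum; apply/eqP/eq_bigr => j _.
by rewrite hornerXn.
Qed.

(** Each fibre of [y ^+ 2 + y] lies in some [{y, y + 1}], so the image has at least half the size of
    [F]. *)
Lemma card_Artin_Schreier :
  (2 ^ n.-1 <= #|[set (y ^+ 2 + y)%R | y : F]|)%N.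
Proof.
pose f (y : F) := y ^+ 2 + y.
rewrite -(leq_pmul2l (isT : (0 < 2)%N)) -expnS prednK // -hF mulnC.
rewrite -sum_nat_const -sum1_card (partition_big_imset f) /=.
apply: leq_sum => c /imsetP [y _ ->{c}].
rewrite sum1_card (@leq_trans #|[set y; (y + 1)%R]|) //; last first.
  by rewrite cards2; case: (_ != _).
apply/subset_leq_card/subsetP => z; rewrite !inE => /eqP fz.
have : (z - y) * (z - (y + 1)) = 0.
  transitivity (f z - f y - 2%:R * (z * y + z - y ^+ 2 - y)).
    by rewrite /f; ring.
  by rewrite fz subrr (pcharf0 F2) mul0r subr0.
by move/eqP; rewrite mulf_eq0 !subr_eq0.
Qed.

(** The image of [y ^+ 2 + y] lies in the kernel of the trace, and the two cardinality bounds force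
    equality. *)
Lemma Hilbert90 (c : F) : Tr n c = 0 -> exists y, y ^+ 2 + y = c.
Proof.
move=> Tc.
suff E : [set y ^+ 2 + y | y : F] = [set c : F | Tr n c == 0].
  have : c \in [set c : F | Tr n c == 0] by rewrite inE Tc.
  by rewrite -E => /imsetP[y _ ->]; exists y.
apply/eqP; rewrite eqEcard (leq_trans card_Tr0 card_Artin_Schreier) andbT.
apply/subsetP => _ /imsetP[y _ ->].
by rewrite inE TrD Tr_sqr addrr_pchar2.
Qed.

Lemma Some_leaf (a : F) :
  (Some a \in leaves (@Gq F)) = (a != 0) && (Tr n a^-1 == 1).
Proof.
have [->|a0] /= := eqVneq a 0.
  (* In characteristic 2, [theta] sends 1 to [1 + 1 = 0], so 0 is not a leaf. *)
  rewrite inE; apply/forallP => /(_ (Some 1)).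
  by rewrite /Gq /= oner_eq0 invr1 addrr_pchar2 // eqxx.
rewrite Tr_eq1 -[Tr n a^-1]Tr_sqr inE; apply/forallP/idP => [leaf|].
  apply/eqP => /Hilbert90 [y Ey].
  have y0 : y != 0.
    by apply: contra_eq_neq Ey => ->; rewrite expr0n addr0 eq_sym sqrf_eq0 invr_eq0.
  have/negP := leaf (Some (a * y)); apply.
  rewrite /Gq /= mulf_eq0 (negbTE a0) (negbTE y0) /=; apply/eqP; congr Some.
  have ay0 : a * y != 0 by rewrite mulf_neq0.
  apply: (mulfI ay0); rewrite mulrDr mulfV //.
  have -> : 1 = a ^+ 2 * (y ^+ 2 + y) by rewrite Ey -exprMn mulfV ?expr1n.
  have -> : a * y * (a * y) + a ^+ 2 * (y ^+ 2 + y) =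
    (a * y) ^+ 2 + (a * y) ^+ 2 + a * y * a by ring.
  by rewrite addrr_pchar2 ?add0r.
(* A preimage [b] of [a] satisfies [b^2 + 1 = b a], so [y = b / a] solves [y^2 + y = a^-2], whose
   trace is then 0. *)
move=> T0 [b|]; rewrite /Gq //=; case: ifPn => // b0.
apply: contraNneq T0 => -[E].
have -> : a^-1 ^+ 2 = (b / a) ^+ 2 + b / a.
  have : b ^+ 2 + 1 = b * a by rewrite -E mulrDr mulfV.
  move/(canRL (addKr _)) => E1.
  have -> : a^-1 ^+ 2 = (- b ^+ 2 + b * a) / a ^+ 2 by rewrite -E1 mul1r exprVn.
  by rewrite oppr_pchar2 //; field.
by rewrite TrD Tr_sqr addrr_pchar2.
Qed.

Lemma dickson_root (a : F) : a != 0 ->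
  ((dickson F (2 ^ n).+1).[a] == 0) = (Tr n a^-1 == 1).
Proof.
move=> a0; rewrite dickson_exp2S // -/(Tr n (a^-1 ^+ 2)) Tr_sqr.
by rewrite mulf_eq0 expf_eq0 (negbTE a0) andbF addrC addr_eq0 oppr_pchar2.
Qed.

Lemma exists_Tr1_TrV1 : exists a : F, Tr n a = 1 /\ Tr n a^-1 = 1.
Proof.
pose T1 := [set a : F | Tr n a == 1]; pose T2 := [set a : F | a^-1 \in T1].
have cT1 : (2 ^ n.-1 <= #|T1|)%N.
  have -> : T1 = ~: [set c : F | Tr n c == 0].
    by apply/setP => a; rewrite !inE Tr_eq1.
  have := card_Tr0; have := cardsC [set c : F | Tr n c == 0].
  by have := expnS 2 n.-1; rewrite hF (prednK hn); lia.
have cT2 : #|T2| = #|T1|.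
  have -> : T2 = GRing.inv @: T1.
    apply/setP => a; rewrite inE; apply/idP/imsetP => [h|[b h ->]].
      by exists a^-1; rewrite ?invrK.
    by rewrite invrK.
  by rewrite card_imset //; apply: invr_inj.
have [/setP E|[a]] := set_0Vmem (T1 :&: T2); last first.
  by rewrite !inE => /andP[/eqP ? /eqP ?]; exists a.
(* The convention [0^-1 = 0] keeps 0 out of [T2] as well. *)
have s0 : T1 :|: T2 \subset [set~ 0].
  apply/subsetP => a; rewrite !inE.
  by apply: contraTneq => ->; rewrite invr0 Tr0 eq_sym oner_eq0.
have := subset_leq_card s0.
rewrite cardsU cT2 (_ : T1 :&: T2 = set0) ?cards0; last exact/setP.
have := cardsC1 (0 : F); rewrite hF => ->.
by have := expnS 2 n.-1; have := expn_gt0 2 n.-1; rewrite (prednK hn); lia.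
Qed.

End Trace.

Theorem lemma4p14 (n : nat) (F : finFieldType)
    (hn : (0 < n)%N) (hF : #|F| = (2 ^ n)%N) :
  L_A F n != set0 /\ [set Some a | a in S_set F (2 ^ n).+1] = L_A F n.
Proof.
have SE (a : F) : (a \in S_set F (2 ^ n).+1) =
    [&& a != 0, Tr n a^-1 == 1 & Tr n a == 1].
  rewrite inE; have [//|a0] /= := eqVneq a 0.
  by rewrite !(dickson_root hn hF) ?invr_eq0 // invrK.
have E : [set Some a | a in S_set F (2 ^ n).+1] = L_A F n.
  apply/setP => -[a|]; last first.
    rewrite inE [None \in leaves _]inE; apply/imsetP/andP => [[]//|[/forallP]].
    by move/(_ None).
  rewrite mem_imset; last by move=> ? ? [].
  rewrite SE inE (Some_leaf hn hF) !inE mem_imset; last by move=> ? ? [].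
  rewrite inE; have [//|a0] /= := eqVneq a 0.
  rewrite (inj_eq (@Some_inj _)) (negbTE a0) !orbF.
  (* Once [Tr n a^-1 = 1], the condition of [A_set] reads [Tr n a = 1]. *)
  by case: eqP => //= ->.
split=> //; rewrite -E; have [a [T1 T2]] := exists_Tr1_TrV1 hn hF.
apply/set0Pn; exists (Some a); apply: imset_f; rewrite SE T1 T2 eqxx !andbT.
by apply: contra_eq_neq T1 => ->; rewrite Tr0 eq_sym oner_eq0.
Qed.
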